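(* Let $\mathcal{E}$ be a Frobenius exact category and let $k\ge 0$ be an integer. Then the exact category $\operatorname{MMor}_k(\mathcal{E})$ is Frobenius exact.
   Context: An exact category (in the sense of Quillen) is Frobenius exact if its classes of projective and injective objects coincide and it has enough projectives and enough injectives, where: $P$ is projective if morphisms out of $P$ lift along admissible epimorphisms, injective objects are dual; enough projectives means every object $X$ admits an admissible epimorphism $P\twoheadrightarrow X$ with $P$ projective, and enough injectives is dual. For $k\ge 0$, $\operatorname{Mor}_k(\mathcal{E})$ is the category of diagrams $X_1\xrightarrow{f_1}\cdots\xrightarrow{f_k}X_{k+1}$ in $\mathcal{E}$ (functors from the poset $\{1<\cdots<k+1\}$), with the componentwise exact structure: $X_\bullet\to Y_\bullet\to Z_\bullet$ is admissible iff each $X_i\to Y_i\to Z_i$ is an admissible short exact sequence in $\mathcal{E}$. $\operatorname{MMor}_k(\mathcal{E})$ is the full subcategory of objects in which every map is an admissible monomorphism in $\mathcal{E}$; its admissible short exact sequences are the sequences of objects of $\operatorname{MMor}_k(\mathcal{E})$ that are admissible in $\operatorname{Mor}_k(\mathcal{E})$. With this class $\operatorname{MMor}_k(\mathcal{E})$ is an exact category. *)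

(* Defs.v *)
From HB Require Import structures.
From mathcomp Require Import all_boot all_algebra.

Set Implicit Arguments.
Unset Strict Implicit.
Unset Printing Implicit Defensive.

Import GRing.Theory.
Local Open Scope ring_scope.

Record preadditive := Preadditive {
  obj :> Type;
  hom : obj -> obj -> zmodType;
  idm : forall X, hom X X;
  comp : forall X Y Z, hom Y Z -> hom X Y -> hom X Z;
  compA : forall X Y Z W (h : hom Z W) (g : hom Y Z) (f : hom X Y),
    comp h (comp g f) = comp (comp h g) f;
  comp1m : forall X Y (f : hom X Y), comp (idm Y) f = f;
  compm1 : forall X Y (f : hom X Y), comp f (idm X) = f;
  compDl : forall X Y Z (g h : hom Y Z) (f : hom X Y),
    comp (g + h) f = comp g f + comp h f;
  compDr : forall X Y Z (h : hom Y Z) (f g : hom X Y),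
    comp h (f + g) = comp h f + comp h g
}.

Arguments hom {C} X Y : rename.
Arguments idm {C} X : rename.
Arguments comp {C X Y Z} g f : rename.

Notation "g \oc f" := (comp g f) (at level 40, left associativity).

Section Categories.
Variable C : preadditive.

Definition is_iso (X Y : C) (f : hom X Y) : Prop :=
  exists g : hom Y X, g \oc f = idm X /\ f \oc g = idm Y.

(* Initial and terminal: existence of the morphisms is automatic, since the
   hom-groups contain 0. *)
Definition is_zero_object (Z : C) : Prop :=
  (forall X (f g : hom X Z), f = g) /\ (forall X (f g : hom Z X), f = g).

Definition is_biproduct (X Y B : C) (i1 : hom X B) (i2 : hom Y B)
    (p1 : hom B X) (p2 : hom B Y) : Prop :=
  [/\ p1 \oc i1 = idm X, p2 \oc i2 = idm Y, p1 \oc i2 = 0, p2 \oc i1 = 0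
    & i1 \oc p1 + i2 \oc p2 = idm B].

Definition is_additive : Prop :=
  (exists Z : C, is_zero_object Z) /\
  (forall X Y : C, exists (B : C) (i1 : hom X B) (i2 : hom Y B)
     (p1 : hom B X) (p2 : hom B Y), is_biproduct i1 i2 p1 p2).

Definition is_kernel (X Y Z : C) (i : hom X Y) (p : hom Y Z) : Prop :=
  p \oc i = 0 /\
  forall (W : C) (f : hom W Y), p \oc f = 0 ->
    exists! g : hom W X, i \oc g = f.

Definition is_cokernel (X Y Z : C) (i : hom X Y) (p : hom Y Z) : Prop :=
  p \oc i = 0 /\
  forall (W : C) (f : hom Y W), f \oc i = 0 ->
    exists! g : hom Z W, g \oc p = f.

(* The square with sides f : X -> Y, g : X -> X', f' : X' -> Y', g' : Y -> Y'. *)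
Definition is_pushout (X Y X' Y' : C) (f : hom X Y) (g : hom X X')
    (f' : hom X' Y') (g' : hom Y Y') : Prop :=
  g' \oc f = f' \oc g /\
  forall (W : C) (a : hom X' W) (b : hom Y W), b \oc f = a \oc g ->
    exists! u : hom Y' W, u \oc f' = a /\ u \oc g' = b.

(* The square with sides f : Y -> Z, g : Z' -> Z, f' : Y' -> Z', g' : Y' -> Y. *)
Definition is_pullback (Y Z Y' Z' : C) (f : hom Y Z) (g : hom Z' Z)
    (f' : hom Y' Z') (g' : hom Y' Y) : Prop :=
  f \oc g' = g \oc f' /\
  forall (W : C) (a : hom W Z') (b : hom W Y), f \oc b = g \oc a ->
    exists! u : hom W Y', f' \oc u = a /\ g' \oc u = b.

Definition seq_class : Type :=
  forall X Y Z : C, hom X Y -> hom Y Z -> Prop.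

Variable S : seq_class.

Definition adm_mono (X Y : C) (i : hom X Y) : Prop :=
  exists (Z : C) (p : hom Y Z), S i p.

Definition adm_epi (Y Z : C) (p : hom Y Z) : Prop :=
  exists (X : C) (i : hom X Y), S i p.

(* Quillen's axioms in the equivalent form of Keller and Buehler, in which the
   "obscure" axiom, being redundant, is omitted. *)
Record is_exact : Prop := IsExact {
  exact_additive : is_additive;
  exact_ker_coker : forall (X Y Z : C) (i : hom X Y) (p : hom Y Z),
    S i p -> is_kernel i p /\ is_cokernel i p;
  exact_iso_closed : forall (X Y Z X' Y' Z' : C)
    (i : hom X Y) (p : hom Y Z) (i' : hom X' Y') (p' : hom Y' Z')
    (a : hom X X') (b : hom Y Y') (c : hom Z Z'),
    is_iso a -> is_iso b -> is_iso c ->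
    b \oc i = i' \oc a -> c \oc p = p' \oc b -> S i p -> S i' p';
  exact_mono_id : forall X : C, adm_mono (idm X);
  exact_epi_id : forall X : C, adm_epi (idm X);
  exact_mono_comp : forall (X Y Z : C) (f : hom X Y) (g : hom Y Z),
    adm_mono f -> adm_mono g -> adm_mono (g \oc f);
  exact_epi_comp : forall (X Y Z : C) (f : hom X Y) (g : hom Y Z),
    adm_epi f -> adm_epi g -> adm_epi (g \oc f);
  exact_pushout : forall (X Y X' : C) (f : hom X Y) (g : hom X X'),
    adm_mono f ->
    exists (Y' : C) (f' : hom X' Y') (g' : hom Y Y'),
      is_pushout f g f' g' /\ adm_mono f';
  exact_pullback : forall (Y Z Z' : C) (f : hom Y Z) (g : hom Z' Z),
    adm_epi f ->
    exists (Y' : C) (f' : hom Y' Z') (g' : hom Y' Y),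
      is_pullback f g f' g' /\ adm_epi f'
}.

Definition is_projective (P : C) : Prop :=
  forall (Y Z : C) (p : hom Y Z) (f : hom P Z), adm_epi p ->
    exists g : hom P Y, p \oc g = f.

Definition is_injective (I : C) : Prop :=
  forall (X Y : C) (i : hom X Y) (f : hom X I), adm_mono i ->
    exists g : hom Y I, g \oc i = f.

Definition enough_projectives : Prop :=
  forall X : C, exists (P : C) (p : hom P X), is_projective P /\ adm_epi p.

Definition enough_injectives : Prop :=
  forall X : C, exists (I : C) (i : hom X I), is_injective I /\ adm_mono i.

Record is_frobenius_exact : Prop := IsFrobeniusExact {
  frobenius_exact : is_exact;
  frobenius_proj_inj : forall P : C, is_projective P <-> is_injective P;
  frobenius_enough_proj : enough_projectives;
  frobenius_enough_inj : enough_injectives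
}.

End Categories.

Section FullSubcategory.
Variables (C : preadditive) (P : C -> Prop).

Definition full_sub : preadditive :=
  @Preadditive {X : C | P X} (fun X Y => hom (sval X) (sval Y))
    (fun X => idm (sval X)) (fun _ _ _ g f => g \oc f)
    (fun _ _ _ _ => @compA C _ _ _ _) (fun _ _ => @comp1m C _ _)
    (fun _ _ => @compm1 C _ _) (fun _ _ _ => @compDl C _ _ _)
    (fun _ _ _ => @compDr C _ _ _).

Definition full_sub_class (S : seq_class C) : seq_class full_sub :=
  fun X Y Z i p => S (sval X) (sval Y) (sval Z) i p.

End FullSubcategory.

(* The library equips only non-dependent finite functions with a zmodType. *)

Section DffunZmod.
Variables (I : finType) (V : I -> zmodType).
Implicit Types f g h : {dffun forall i, V i}.

Definition dffun_zero : {dffun forall i, V i} := [ffun i => 0 : V i].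
Definition dffun_opp f : {dffun forall i, V i} := [ffun i => - f i : V i].
Definition dffun_add f g : {dffun forall i, V i} := [ffun i => f i + g i : V i].

Fact dffun_addA : associative dffun_add.
Proof. by move=> f g h; apply/ffunP=> i; rewrite !ffunE addrA. Qed.
Fact dffun_addC : commutative dffun_add.
Proof. by move=> f g; apply/ffunP=> i; rewrite !ffunE addrC. Qed.
Fact dffun_add0 : left_id dffun_zero dffun_add.
Proof. by move=> f; apply/ffunP=> i; rewrite !ffunE add0r. Qed.
Fact dffun_addN : left_inverse dffun_zero dffun_opp dffun_add.
Proof. by move=> f; apply/ffunP=> i; rewrite !ffunE addNr. Qed.

HB.instance Definition _ := GRing.isZmodule.Build {dffun forall i, V i}
  dffun_addA dffun_addC dffun_add0 dffun_addN.

Lemma dffun0E i : (0 : {dffun forall i, V i}) i = 0.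
Proof. by rewrite ffunE. Qed.
Lemma dffunNE f i : (- f) i = - f i.
Proof. by rewrite ffunE. Qed.
Lemma dffunDE f g i : (f + g) i = f i + g i.
Proof. by rewrite ffunE. Qed.

End DffunZmod.

Section Mor.
Variables (C : preadditive) (k : nat).

Lemma comp0m (X Y Z : C) (f : hom X Y) : (0 : hom Y Z) \oc f = 0.
Proof. by apply: (addrI (0 \oc f)); rewrite -compDl !addr0. Qed.
Lemma compm0 (X Y Z : C) (g : hom Y Z) : g \oc (0 : hom X Y) = 0.
Proof. by apply: (addrI (g \oc 0)); rewrite -compDr !addr0. Qed.
Lemma compNl (X Y Z : C) (g : hom Y Z) (f : hom X Y) :
  (- g) \oc f = - (g \oc f).
Proof. by apply: (addrI (g \oc f)); rewrite -compDl !subrr comp0m. Qed.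
Lemma compNr (X Y Z : C) (g : hom Y Z) (f : hom X Y) :
  g \oc (- f) = - (g \oc f).
Proof. by apply: (addrI (g \oc f)); rewrite -compDr !subrr compm0. Qed.

Definition osrc (i : 'I_k) : 'I_k.+1 := widen_ord (leqnSn k) i.
Definition otgt (i : 'I_k) : 'I_k.+1 := lift ord0 i.

(* Indices are shifted down by one: the diagram X_1 -> ... -> X_(k+1) has
   objects dobj 0, ..., dobj k and maps dmap i : dobj i -> dobj i.+1. *)
Record diagram := Diagram {
  dobj :> 'I_k.+1 -> C;
  dmap : forall i : 'I_k, hom (dobj (osrc i)) (dobj (otgt i))
}.

Definition natural (X Y : diagram) :
    pred {dffun forall i : 'I_k.+1, hom (X i) (Y i)} :=
  fun f => [forall i : 'I_k,
    f (otgt i) \oc dmap X i == dmap Y i \oc f (osrc i)].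
Arguments natural : clear implicits.

Fact natural_zmod_closed X Y : zmod_closed (natural X Y).
Proof.
split=> [|f g /forallP/= nf /forallP/= ng]; apply/forallP=> i /=.
  by rewrite !ffunE comp0m compm0.
rewrite !ffunE compDl compDr compNl compNr.
by rewrite (eqP (nf i)) (eqP (ng i)).
Qed.
HB.instance Definition _ X Y :=
  GRing.isZmodClosed.Build _ (natural X Y) (natural_zmod_closed X Y).

Record mor_hom (X Y : diagram) := MorHom {
  mor_val :> {dffun forall i : 'I_k.+1, hom (X i) (Y i)};
  mor_natural : natural X Y mor_val
}.

HB.instance Definition _ X Y := [isSub for @mor_val X Y].
HB.instance Definition _ X Y := [Choice of mor_hom X Y by <:].
HB.instance Definition _ X Y := [SubChoice_isSubZmodule of mor_hom X Y by <:].

Fact mor_id_natural (X : diagram) : natural X X [ffun i => idm (X i)].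
Proof. by apply/forallP=> i /=; rewrite !ffunE comp1m compm1. Qed.
Definition mor_id X : mor_hom X X := MorHom (mor_id_natural X).

Fact mor_comp_natural (X Y Z : diagram) (g : mor_hom Y Z) (f : mor_hom X Y) :
  natural X Z [ffun i => g i \oc f i].
Proof.
apply/forallP=> i /=; rewrite !ffunE -compA.
rewrite (eqP (forallP (mor_natural f) i)) compA.
by rewrite (eqP (forallP (mor_natural g) i)) compA.
Qed.
Definition mor_comp X Y Z (g : mor_hom Y Z) (f : mor_hom X Y) : mor_hom X Z :=
  MorHom (mor_comp_natural g f).

Fact mor_compA X Y Z W (h : mor_hom Z W) (g : mor_hom Y Z) (f : mor_hom X Y) :
  mor_comp h (mor_comp g f) = mor_comp (mor_comp h g) f.
Proof. by apply/val_inj/ffunP=> i; rewrite !ffunE compA. Qed.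
Fact mor_comp1m X Y (f : mor_hom X Y) : mor_comp (mor_id Y) f = f.
Proof. by apply/val_inj/ffunP=> i; rewrite !ffunE comp1m. Qed.
Fact mor_compm1 X Y (f : mor_hom X Y) : mor_comp f (mor_id X) = f.
Proof. by apply/val_inj/ffunP=> i; rewrite !ffunE compm1. Qed.
Fact mor_compDl X Y Z (g h : mor_hom Y Z) (f : mor_hom X Y) :
  mor_comp (g + h) f = mor_comp g f + mor_comp h f.
Proof. by apply/val_inj/ffunP=> i; rewrite !ffunE compDl. Qed.
Fact mor_compDr X Y Z (h : mor_hom Y Z) (f g : mor_hom X Y) :
  mor_comp h (f + g) = mor_comp h f + mor_comp h g.
Proof. by apply/val_inj/ffunP=> i; rewrite !ffunE compDr. Qed.

Definition Mor : preadditive :=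
  @Preadditive diagram mor_hom mor_id mor_comp
    mor_compA mor_comp1m mor_compm1 mor_compDl mor_compDr.

Variable S : seq_class C.

Definition Mor_class : seq_class Mor :=
  fun X Y Z (a : mor_hom X Y) (b : mor_hom Y Z) =>
    forall i : 'I_k.+1, S (a i) (b i).

Definition all_adm_mono (X : Mor) : Prop :=
  forall i : 'I_k, adm_mono S (dmap X i).

Definition MMor : preadditive := full_sub all_adm_mono.

Definition MMor_class : seq_class MMor := full_sub_class Mor_class.

End Mor.

(* Main.v *)
From mathcomp Require Import all_boot all_algebra.
Require Import Defs.

Set Implicit Arguments.
Unset Strict Implicit.
Unset Printing Implicit Defensive.

Import GRing.Theory.
Local Open Scope ring_scope.

(** In a Frobenius exact category E, call a diagram X_0 -> ... -> X_k of
    admissible monomorphisms componentwise projective (injective) if all the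
    X_i are.  The proof that MMor_k(E) is Frobenius exact rests on three facts.

    Extension lemma (adm_mono_extension).  In a morphism of admissible
    sequences whose outer components are admissible monomorphisms, the middle
    component is one too.  This gives the exact structure of MMor_k(E)
    (MMor_exact): biproducts, pushouts, pullbacks, and the cokernels and kernels
    of composites are formed componentwise, and each time the new structure maps
    are middle components of this kind, because a pushout has the same
    cokernel, a pullback has the same kernel, and composites are governed by the
    third isomorphism theorem (exact_noether) and its dual.

    Componentwise projective diagrams are projective, and componentwise
    injective diagrams are injective (MMor_projective, MMor_injective).  A
    morphism is lifted or extended one component after the other.  Any choice
    in the next component can be corrected to become natural: in the projective
    case because X_i, being injective as well, is a retract of X_(i+1); in the
    injective case because the failure of naturality vanishes on the subdiagram
    and so factors through the quotient diagram, along whose admissible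
    monomorphisms it can be extended.

    Every diagram is a quotient of a componentwise projective one and embeds
    into a componentwise injective one, again by going from each component to
    the next (projective_presentation_step, injective_copresentation_step).

    Hence a diagram is projective, as a retract of a componentwise projective
    one, if and only if it is componentwise projective; dually for injectives;
    and the two componentwise notions agree because E is Frobenius.  Results on
    admissible epimorphisms in E that are dual to results on admissible
    monomorphisms are deduced by passing to the opposite category. *)

(** * Universal properties in preadditive categories *)

Section Universal.
Variable C : preadditive.

Lemma compBl (X Y Z : C) (g h : hom Y Z) (f : hom X Y) :
  (g - h) \oc f = g \oc f - h \oc f.
Proof. by rewrite compDl compNl. Qed.

Lemma compBr (X Y Z : C) (h : hom Y Z) (f g : hom X Y) :
  h \oc (f - g) = h \oc f - h \oc g.
Proof. by rewrite compDr compNr. Qed.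

Lemma is_kernel_mono (X Y Z W : C) (i : hom X Y) (p : hom Y Z) (g h : hom W X) :
  is_kernel i p -> i \oc g = i \oc h -> g = h.
Proof.
move=> [pi0 U] e; have [|u [_ uu]] := U W (i \oc h).
  by rewrite compA pi0 comp0m.
by rewrite -(uu g e) (uu h).
Qed.

Lemma is_kernel_lift (X Y Z W : C) (i : hom X Y) (p : hom Y Z) (f : hom W Y) :
  is_kernel i p -> p \oc f = 0 -> exists g, i \oc g = f.
Proof. by move=> [_ U] /U [g [e _]]; exists g. Qed.

Lemma is_kernel_intro (X Y Z : C) (i : hom X Y) (p : hom Y Z) :
    p \oc i = 0 ->
    (forall W (g : hom W X), i \oc g = 0 -> g = 0) ->
    (forall W (f : hom W Y), p \oc f = 0 -> exists g, i \oc g = f) ->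
  is_kernel i p.
Proof.
move=> pi0 mono lift; split=> // W f /lift[g e]; exists g; split=> // h eh.
by apply/eqP; rewrite -subr_eq0; apply/eqP/mono; rewrite compBr e eh subrr.
Qed.

Lemma is_iso_id (X : C) : is_iso (idm X).
Proof. by exists (idm X); rewrite comp1m. Qed.

Lemma is_pushout_sym (X Y X' Y' : C) (f : hom X Y) (g : hom X X')
    (f' : hom X' Y') (g' : hom Y Y') :
  is_pushout f g f' g' -> is_pushout g f g' f'.
Proof.
move=> [e U]; split=> // W a b eab.
have [u [[ua ub] uu]] := U W b a (esym eab).
by exists u; split=> // v [va vb]; apply: uu.
Qed.

Lemma is_pushout_ext (X Y X' Y' W : C) (f : hom X Y) (g : hom X X')
    (f' : hom X' Y') (g' : hom Y Y') (u v : hom Y' W) :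
  is_pushout f g f' g' -> u \oc f' = v \oc f' -> u \oc g' = v \oc g' -> u = v.
Proof.
move=> [e U] ef eg; have [|w [_ uw]] := U W (v \oc f') (v \oc g').
  by rewrite -!compA e.
by rewrite -(uw u) // (uw v).
Qed.

Lemma is_pushout_desc (X Y X' Y' W : C) (f : hom X Y) (g : hom X X')
    (f' : hom X' Y') (g' : hom Y Y') (a : hom X' W) (b : hom Y W) :
  is_pushout f g f' g' -> b \oc f = a \oc g ->
  exists u, u \oc f' = a /\ u \oc g' = b.
Proof. by move=> [_ U] /U[u [e _]]; exists u. Qed.

Lemma is_zero_object_idm0 (Z : C) : is_zero_object Z <-> idm Z = 0.
Proof.
split=> [[+ _]|e]; first by apply.
split=> X f g.
  by rewrite -[f]comp1m -[g]comp1m e !comp0m.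
by rewrite -[f]compm1 -[g]compm1 e !compm0.
Qed.

Lemma is_cokernel_intro (X Y Z : C) (i : hom X Y) (p : hom Y Z) :
    p \oc i = 0 ->
    (forall W (g : hom Z W), g \oc p = 0 -> g = 0) ->
    (forall W (f : hom Y W), f \oc i = 0 -> exists g, g \oc p = f) ->
  is_cokernel i p.
Proof.
move=> pi0 epi desc; split=> // W f /desc[g e]; exists g; split=> // h eh.
by apply/eqP; rewrite -subr_eq0; apply/eqP/epi; rewrite compBl e eh subrr.
Qed.

(** The opposite category, with the same hom-groups.  The statements of
    universal properties in C and in its opposite are convertible, so that a
    lemma applied to op C is a proof of the dual lemma in C. *)
Definition op : preadditive :=
  @Preadditive C (fun X Y => hom Y X) (fun X => idm X)
    (fun _ _ _ g f => f \oc g)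
    (fun _ _ _ _ h g f => esym (compA f g h)) (fun _ _ => @compm1 C _ _)
    (fun _ _ => @comp1m C _ _) (fun _ _ _ g h f => compDr f g h)
    (fun _ _ _ h f g => compDl f g h).

End Universal.

Section Opposite.
Variable C : preadditive.

Lemma is_cokernel_epi (X Y Z W : C) (i : hom X Y) (p : hom Y Z)
    (g h : hom Z W) : is_cokernel i p -> g \oc p = h \oc p -> g = h.
Proof. by move=> H; apply: (@is_kernel_mono (op C) Z Y X W p i). Qed.

Lemma is_cokernel_desc (X Y Z W : C) (i : hom X Y) (p : hom Y Z)
    (f : hom Y W) : is_cokernel i p -> f \oc i = 0 -> exists g, g \oc p = f.
Proof. by move=> H; apply: (@is_kernel_lift (op C) Z Y X W p i). Qed.

Lemma is_pullback_ext (Y Z Y' Z' W : C) (f : hom Y Z) (g : hom Z' Z)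
    (f' : hom Y' Z') (g' : hom Y' Y) (u v : hom W Y') :
  is_pullback f g f' g' -> f' \oc u = f' \oc v -> g' \oc u = g' \oc v -> u = v.
Proof. exact: (@is_pushout_ext (op C) Z Y Z' Y' W f g f' g'). Qed.

Lemma is_pullback_lift (Y Z Y' Z' W : C) (f : hom Y Z) (g : hom Z' Z)
    (f' : hom Y' Z') (g' : hom Y' Y) (a : hom W Z') (b : hom W Y) :
  is_pullback f g f' g' -> f \oc b = g \oc a ->
  exists u, f' \oc u = a /\ g' \oc u = b.
Proof. exact: (@is_pushout_desc (op C) Z Y Z' Y' W f g f' g' a b). Qed.

(** The opposite of a class of sequences. *)
Definition op_class (S : seq_class C) : seq_class (op C) :=
  fun X Y Z i p => S Z Y X p i.

Lemma op_is_exact (S : seq_class C) : is_exact S -> is_exact (op_class S).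
Proof.
move=> ex; split.
- have [[Z [Z1 Z2]] bip] := exact_additive ex; split; first by exists Z.
  move=> X Y; have [B [i1 [i2 [p1 [p2 [*]]]]]] := bip X Y.
  by exists B, p1, p2, i1, i2.
- by move=> X Y Z i p /(exact_ker_coker ex)[].
- move=> X Y Z X' Y' Z' i p i' p' a b c.
  move=> [a' [/= a'1 a'2]] [b' [/= b'1 b'2]] [c' [/= c'1 c'2]] /= ei ep.
  apply: (exact_iso_closed ex (a := c') (b := b') (c := a')).
  + by exists c.
  + by exists b.
  + by exists a.
  + rewrite -(@compm1 C _ _ p) -c'1 (@compA C _ _ _ _ p) ep.
    by rewrite !compA b'2 comp1m.
  + rewrite -(@compm1 C _ _ i) -b'1 (@compA C _ _ _ _ i) ei.
    by rewrite !compA a'2 comp1m.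
- exact: exact_epi_id ex.
- exact: exact_mono_id ex.
- by move=> X Y Z f g ff gg; apply: (exact_epi_comp ex gg ff).
- by move=> X Y Z f g ff gg; apply: (exact_mono_comp ex gg ff).
- by move=> X Y X'; apply: (exact_pullback ex).
- by move=> Y Z Z'; apply: (exact_pushout ex).
Qed.

End Opposite.

(** * Exact categories *)

Section Exact.
Variables (C : preadditive) (S : seq_class C).
Hypothesis ex : is_exact S.

Lemma exact_kernel (X Y Z : C) (i : hom X Y) (p : hom Y Z) :
  S i p -> is_kernel i p.
Proof. by case/(exact_ker_coker ex). Qed.

Lemma exact_cokernel (X Y Z : C) (i : hom X Y) (p : hom Y Z) :
  S i p -> is_cokernel i p.
Proof. by case/(exact_ker_coker ex). Qed.

Lemma exact_comp0 (X Y Z : C) (i : hom X Y) (p : hom Y Z) :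
  S i p -> p \oc i = 0.
Proof. by case/exact_kernel. Qed.

Lemma exact_monic (X Y Z W : C) (i : hom X Y) (p : hom Y Z) (g h : hom W X) :
  S i p -> i \oc g = i \oc h -> g = h.
Proof. by move=> /exact_kernel/is_kernel_mono; apply. Qed.

Lemma exact_epic (X Y Z W : C) (i : hom X Y) (p : hom Y Z) (g h : hom Z W) :
  S i p -> g \oc p = h \oc p -> g = h.
Proof. by move=> /exact_cokernel/is_cokernel_epi; apply. Qed.

Lemma exact_lift (X Y Z W : C) (i : hom X Y) (p : hom Y Z) (f : hom W Y) :
  S i p -> p \oc f = 0 -> exists g, i \oc g = f.
Proof. by move=> /exact_kernel/is_kernel_lift; apply. Qed.

Lemma exact_desc (X Y Z W : C) (i : hom X Y) (p : hom Y Z) (f : hom Y W) :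
  S i p -> f \oc i = 0 -> exists g, g \oc p = f.
Proof. by move=> /exact_cokernel/is_cokernel_desc; apply. Qed.

(** Any cokernel of an admissible monomorphism completes it to an admissible
    sequence. *)
Lemma adm_mono_cokernel (X Y Z : C) (i : hom X Y) (p : hom Y Z) :
  adm_mono S i -> is_cokernel i p -> S i p.
Proof.
move=> [Z' [q Sq]] cp.
have [c ec] := exact_desc Sq cp.1.
have [c' [ec' _]] := cp.2 _ _ (exact_comp0 Sq).
apply: (exact_iso_closed ex (is_iso_id X) (is_iso_id Y) (c := c) _ _ _ Sq).
- exists c'; split.
    by apply: (exact_epic Sq); rewrite -compA ec ec' comp1m.
  by apply: (is_cokernel_epi cp); rewrite -compA ec' ec comp1m.
- by rewrite comp1m compm1.
- by rewrite compm1.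
Qed.

End Exact.

Section Pushout.
Variables (C : preadditive) (S : seq_class C).
Hypothesis ex : is_exact S.

(** The axiom on pushouts provides some pushout that is an admissible
    monomorphism; by uniqueness every pushout is. *)
Lemma adm_mono_pushout (X Y X' Y' : C) (f : hom X Y) (g : hom X X')
    (f' : hom X' Y') (g' : hom Y Y') :
  is_pushout f g f' g' -> adm_mono S f -> adm_mono S f'.
Proof.
move=> po /(fun H => exact_pushout ex g H)[Y2 [f2 [g2 [po2 [Z [p Sp]]]]]].
have [u [uf ug]] := is_pushout_desc po2 po.1.
have [v [vf vg]] := is_pushout_desc po po2.1.
have uv : u \oc v = idm Y'.
  by apply: (is_pushout_ext po); rewrite -compA ?vf ?vg ?uf ?ug comp1m.
have vu : v \oc u = idm Y2.
  by apply: (is_pushout_ext po2); rewrite -compA ?uf ?ug ?vf ?vg comp1m.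
exists Z, (p \oc v).
apply: (exact_iso_closed ex (is_iso_id X') (b := u) _ (is_iso_id Z) _ _ Sp).
- by exists v.
- by rewrite uf compm1.
- by rewrite comp1m -compA vu compm1.
Qed.

(** A pushout of an admissible monomorphism has the same cokernel. *)
Lemma exact_of_pushout (X Y W X' Y' : C) (f : hom X Y) (p : hom Y W)
    (g : hom X X') (f' : hom X' Y') (g' : hom Y Y') (p' : hom Y' W) :
  S f p -> is_pushout f g f' g' -> p' \oc f' = 0 -> p' \oc g' = p -> S f' p'.
Proof.
move=> Sf po pf pg; apply: (adm_mono_cokernel ex).
  by apply: (adm_mono_pushout po); exists W, p.
apply: is_cokernel_intro => [//|V h h0|V h h0].
  by apply: (exact_epic ex Sf); rewrite -pg compA h0 !comp0m.
have [|e ee] := exact_desc ex Sf (f := h \oc g').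
  by rewrite -compA po.1 compA h0 comp0m.
exists e; apply: (is_pushout_ext po); first by rewrite -compA pf compm0.
by rewrite -compA pg.
Qed.

Lemma exact_pushout_seq (X Y W X' : C) (f : hom X Y) (p : hom Y W)
    (g : hom X X') : S f p ->
  exists (Y' : C) (f' : hom X' Y') (g' : hom Y Y') (p' : hom Y' W),
    [/\ is_pushout f g f' g', p' \oc g' = p & S f' p'].
Proof.
move=> Sf; have [|Y' [f' [g' [po _]]]] := exact_pushout ex (f := f) g.
  by exists W, p.
have [|p' [pf pg]] := is_pushout_desc po (a := 0) (b := p).
  by rewrite comp0m (exact_comp0 ex Sf).
by exists Y', f', g', p'; split=> //; apply: (exact_of_pushout Sf po).
Qed.

(** The third isomorphism theorem: for X included in Y and Y in Z, the
    sequence Y/X -> Z/X -> Z/Y is admissible.  Indeed Y/X -> Z/X is the pushout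
    of Y -> Z along Y -> Y/X. *)
Lemma exact_noether (X Y Z U V W : C) (f : hom X Y) (p : hom Y U)
    (g : hom Y Z) (q : hom Z V) (r : hom Z W) (s : hom U W) (t : hom W V) :
  S f p -> S g q -> S (g \oc f) r -> s \oc p = r \oc g -> t \oc r = q -> S s t.
Proof.
move=> Sf Sg Sr sp tr.
have po : is_pushout g p s r.
  split=> [//|T a b e].
  have [|u eu] := exact_desc ex Sr (f := b).
    by rewrite compA e -compA (exact_comp0 ex Sf) compm0.
  exists u; split=> [|v [va vb]]; last by apply: (exact_epic ex Sr); rewrite eu.
  by split=> //; apply: (exact_epic ex Sf); rewrite -compA sp compA eu.
apply: (exact_of_pushout Sg po) => //.
apply: (exact_epic ex Sf); rewrite -compA sp compA tr comp0m.
exact: exact_comp0 Sg.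
Qed.

Lemma exact_id_zero (X Z : C) (p : hom X Z) : is_zero_object Z -> S (idm X) p.
Proof.
move=> Z0; apply: (adm_mono_cokernel ex (exact_mono_id ex X)).
split=> [|W f]; first exact: Z0.1.
rewrite compm1 => ->; exists 0; split=> [|h _]; first by rewrite comp0m.
exact: Z0.2.
Qed.

End Pushout.

Section Pullback.
Variables (C : preadditive) (S : seq_class C).
Hypothesis ex : is_exact S.
Let opx := op_is_exact ex.

Lemma adm_epi_kernel (X Y Z : C) (i : hom X Y) (p : hom Y Z) :
  adm_epi S p -> is_kernel i p -> S i p.
Proof. exact: (@adm_mono_cokernel (op C) _ opx Z Y X p i). Qed.

Lemma exact_zero_id (X Z : C) (i : hom Z X) : is_zero_object Z -> S i (idm X).
Proof. by move=> Z0; apply: (exact_id_zero opx); split; apply Z0. Qed.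

Lemma exact_pullback_seq (K Y Z Z' : C) (i : hom K Y) (f : hom Y Z)
    (g : hom Z' Z) : S i f ->
  exists (Y' : C) (f' : hom Y' Z') (g' : hom Y' Y) (i' : hom K Y'),
    [/\ is_pullback f g f' g', g' \oc i' = i & S i' f'].
Proof. exact: (@exact_pushout_seq (op C) _ opx Z Y K Z' f i g). Qed.

(** The dual of the third isomorphism theorem: the kernels of f, of the
    composite of f and g, and of g form an admissible sequence. *)
Lemma exact_noether_kernels (X Y Z K L N : C) (i : hom K X) (f : hom X Y)
    (j : hom L Y) (g : hom Y Z) (n : hom N X) (t : hom K N) (s : hom N L) :
  S i f -> S j g -> S n (g \oc f) -> j \oc s = f \oc n -> n \oc t = i -> S t s.
Proof.
move=> Si Sj Sn.
by apply: (@exact_noether (op C) _ opx Z Y X L K N g j f i n s t).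
Qed.

Lemma exact_biproduct (X Y B : C) (i1 : hom X B) (i2 : hom Y B)
    (p1 : hom B X) (p2 : hom B Y) : is_biproduct i1 i2 p1 p2 -> S i1 p2.
Proof.
move=> [e11 e22 e12 e21 e1].
have [[Z Z0] _] := exact_additive ex.
(* the biproduct is the pushout of 0 -> Y along 0 -> X *)
have po : is_pushout (0 : hom Z Y) (0 : hom Z X) i1 i2.
  split=> [|W a b _]; first by rewrite !compm0.
  exists (a \oc p1 + b \oc p2); split=> [|u [<- <-]].
    by rewrite !compDl -!compA e11 e12 e21 e22 !compm0 !compm1 addr0 add0r.
  by rewrite -!compA -compDr e1 compm1.
by apply: (exact_of_pushout ex _ po e21 e22); apply: exact_zero_id.
Qed.

(** The extension lemma: in a morphism of admissible sequences whose outer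
    components are admissible monomorphisms, so is the middle one.  It factors
    through the pushout D of X -> Y along a as b1 : Y -> D, a pushout of a,
    followed by b2 : D -> Y'. *)
Lemma adm_mono_extension (X Y Z X' Y' Z' : C)
    (i : hom X Y) (p : hom Y Z) (i' : hom X' Y') (p' : hom Y' Z')
    (a : hom X X') (b : hom Y Y') (c : hom Z Z') :
  S i p -> S i' p' -> b \oc i = i' \oc a -> c \oc p = p' \oc b ->
  adm_mono S a -> adm_mono S c -> adm_mono S b.
Proof.
move=> Si Si' ei ep aa [V [q Sq]].
have [D [iD [b1 [pD [po pb SD]]]]] := exact_pushout_seq ex a Si.
have [b2 [b2i b2b]] := is_pushout_desc po ei.
have pb2 : p' \oc b2 = c \oc pD.
  apply: (is_pushout_ext po); rewrite -!compA ?b2i ?b2b.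
    by rewrite (exact_comp0 ex Si') (exact_comp0 ex SD) compm0.
  by rewrite pb ep.
have b2_mono W (w : hom W D) : b2 \oc w = 0 -> w = 0.
  move=> w0; have [|v ev] := exact_lift ex SD (f := w).
    by apply: (exact_monic ex Sq); rewrite compA -pb2 -compA w0 !compm0.
  rewrite -ev; suff -> : v = 0 by rewrite compm0.
  by apply: (exact_monic ex Si'); rewrite -b2i -compA ev w0 compm0.
suff bb2 : adm_mono S b2.
  rewrite -b2b; apply: (exact_mono_comp ex _ bb2).
  exact: (adm_mono_pushout ex (is_pushout_sym po)).
(* b2 is the kernel of the admissible epimorphism Y' -> Z' -> Z'/Z = V *)
exists V, (q \oc p'); apply: adm_epi_kernel.
  by apply: (exact_epi_comp ex); [exists X', i' | exists Z, c].
apply: is_kernel_intro => // [|W f qf].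
  by rewrite -compA pb2 compA (exact_comp0 ex Sq) comp0m.
have [|h eh] := exact_lift ex Sq (f := p' \oc f); first by rewrite compA.
(* after pulling back along D -> Z the morphism f lifts to D, and the lift
   descends again because b2 is monic *)
have [E [e [h' [l [pbk _ Se]]]]] := exact_pullback_seq h SD.
have [|u eu] := exact_lift ex Si' (f := f \oc e - b2 \oc h').
  by rewrite compBr !compA pb2 -!compA pbk.1 compA -eh -compA subrr.
have ev : b2 \oc (h' + iD \oc u) = f \oc e.
  by rewrite compDr compA b2i eu addrC subrK.
have [|g eg] := exact_desc ex Se (f := h' + iD \oc u).
  by apply: b2_mono; rewrite compA ev -compA (exact_comp0 ex Se) compm0.
by exists g; apply: (exact_epic ex Se); rewrite -compA eg.
Qed.

End Pullback.

Lemma adm_epi_extension (C : preadditive) (S : seq_class C) (X Y Z X' Y' Z' : C)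
    (i : hom X Y) (p : hom Y Z) (i' : hom X' Y') (p' : hom Y' Z')
    (a : hom X X') (b : hom Y Y') (c : hom Z Z') :
  is_exact S -> S _ _ _ i p -> S _ _ _ i' p' ->
  b \oc i = i' \oc a -> c \oc p = p' \oc b ->
  adm_epi S a -> adm_epi S c -> adm_epi S b.
Proof.
move=> ex Si Si' ei ep aa ac.
exact: (@adm_mono_extension (op C) _ (op_is_exact ex) Z' Y' X' Z Y X
  p' i' p i c b a Si' Si (esym ep) (esym ei) ac aa).
Qed.

Lemma is_biproduct_sym (C : preadditive) (X Y B : C) (i1 : hom X B)
    (i2 : hom Y B) (p1 : hom B X) (p2 : hom B Y) :
  is_biproduct i1 i2 p1 p2 -> is_biproduct i2 i1 p2 p1.
Proof. by case=> *; split=> //; rewrite addrC. Qed.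

(** * Projective and injective objects *)

Section ProjectivesInjectives.
Variables (C : preadditive) (S : seq_class C).

Lemma is_projective_retract (P Q : C) (s : hom Q P) (r : hom P Q) :
  r \oc s = idm Q -> is_projective S P -> is_projective S Q.
Proof.
move=> rs proj Y Z p f ap; have [g eg] := proj _ _ p (f \oc r) ap.
by exists (g \oc s); rewrite compA eg -compA rs compm1.
Qed.

Lemma is_injective_retract (I J : C) (s : hom J I) (r : hom I J) :
  r \oc s = idm J -> is_injective S I -> is_injective S J.
Proof.
move=> rs inj X Y i f ai; have [g eg] := inj _ _ i (s \oc f) ai.
by exists (r \oc g); rewrite -compA eg compA rs comp1m.
Qed.

Lemma is_projective_biproduct (P Q B : C) (i1 : hom P B) (i2 : hom Q B)
    (p1 : hom B P) (p2 : hom B Q) :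
  is_biproduct i1 i2 p1 p2 ->
  is_projective S P -> is_projective S Q -> is_projective S B.
Proof.
move=> [_ _ _ _ e] projP projQ Y Z p f ap.
have [g1 e1] := projP _ _ p (f \oc i1) ap.
have [g2 e2] := projQ _ _ p (f \oc i2) ap.
exists (g1 \oc p1 + g2 \oc p2).
by rewrite compDr !compA e1 e2 -!compA -compDr e compm1.
Qed.

(** An admissible sequence presenting X as a quotient of a projective object. *)
Record projective_presentation (X : C) := ProjectivePresentation {
  pp_ker : C;
  pp_obj : C;
  pp_incl : hom pp_ker pp_obj;
  pp_proj : hom pp_obj X;
  pp_projective : is_projective S pp_obj;
  pp_exact : S pp_incl pp_proj
}.

(** An admissible sequence embedding X into an injective object. *)
Record injective_copresentation (X : C) := InjectiveCopresentation {
  ic_obj : C;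
  ic_coker : C;
  ic_incl : hom X ic_obj;
  ic_proj : hom ic_obj ic_coker;
  ic_injective : is_injective S ic_obj;
  ic_exact : S ic_incl ic_proj
}.

Hypothesis ex : is_exact S.

(** The new projective object P' is the biproduct of P and a projective object
    Q mapping onto X'.  The kernel K' of P' -> X' is an extension of P by the
    kernel L of Q -> X', which is why K -> K' is an admissible monomorphism. *)
Lemma projective_presentation_step (X X' : C) (x : hom X X') :
  enough_projectives S ->
  forall t : projective_presentation X,
  exists (t' : projective_presentation X') (l : hom (pp_ker t) (pp_ker t'))
      (m : hom (pp_obj t) (pp_obj t')),
    [/\ adm_mono S l, adm_mono S m, m \oc pp_incl t = pp_incl t' \oc l
      & pp_proj t' \oc m = x \oc pp_proj t].
Proof.
move=> enough [K P i p /= projP Sip].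
have [Q [q [projQ [L [j Sjq]]]]] := enough X'.
have [[Z Z0] bip] := exact_additive ex.
have [P' [i1 [i2 [p1 [p2 bP]]]]] := bip P Q.
have [e11 e22 e12 e21 e1] := bP.
(* K' is the pullback of P -> X' and Q -> X', embedded in P' by u and -v *)
have [K' [u [v [j' [pbk vj Sju]]]]] := exact_pullback_seq ex (x \oc p) Sjq.
pose i' := i1 \oc u - i2 \oc v.
pose p' := x \oc p \oc p1 + q \oc p2.
have p1i' : p1 \oc i' = u.
  by rewrite compBr !compA e11 e12 comp0m subr0 comp1m.
have p2i' : p2 \oc i' = - v.
  by rewrite compBr !compA e21 e22 comp0m sub0r comp1m.
have p'i1 : p' \oc i1 = x \oc p.
  by rewrite compDl -!compA e11 e21 !compm0 addr0 compm1.
have p'i2 : p' \oc i2 = q.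
  by rewrite compDl -!compA e12 e22 !compm0 add0r compm1.
have ker' : is_kernel i' p'.
  apply: is_kernel_intro => [|W g g0|W f f0].
  - by rewrite compBr !compA p'i1 p'i2 pbk.1 subrr.
  - apply: (is_pullback_ext pbk).
      by rewrite -p1i' -compA g0 !compm0.
    by apply: oppr_inj; rewrite -!compNl -p2i' -!compA g0 !compm0.
  - have [|g [ug vg]] :=
      is_pullback_lift pbk (a := p1 \oc f) (b := - (p2 \oc f)).
      apply/eqP; rewrite compNr eq_sym -addr_eq0 !compA -compDl.
      by rewrite -/p' f0.
    exists g; rewrite compBl -!compA ug vg compNr opprK.
    by rewrite !compA -compDl e1 comp1m.
have epi' : adm_epi S p'.
  (* compare Q -> P' -> P with X' = X' -> 0 *)
  apply: (adm_epi_extension ex (exact_biproduct ex (is_biproduct_sym bP))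
    (exact_id_zero ex 0 Z0) (a := q) (c := 0)).
  - by rewrite p'i2 comp1m.
  - by rewrite !comp0m.
  - by exists L, j.
  - by exists P, (idm P); apply: exact_id_zero.
have Sp' : S i' p' by apply: (adm_epi_kernel ex).
have [l el] : exists l, i' \oc l = i1 \oc i.
  apply: (exact_lift ex Sp').
  by rewrite compA p'i1 -compA (exact_comp0 ex Sip) compm0.
have projP' := is_projective_biproduct bP projP projQ.
exists (ProjectivePresentation projP' Sp'), l, i1; split=> //=.
- (* compare 0 -> K = K with L -> K' -> P *)
  have ul : u \oc l = i by rewrite -p1i' -compA el compA e11 comp1m.
  apply: (adm_mono_extension ex (exact_zero_id ex 0 Z0) Sju (a := 0) (c := i)).
  + by rewrite !compm0.
  + by rewrite compm1.
  + by exists L, (idm L); apply: exact_zero_id.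
  + by exists X, p.
- by exists Q, p2; apply: (exact_biproduct ex bP).
Qed.

(** The new injective object I' contains the pushout J of I and X' under X,
    and I/X = J/X' embeds into I'/X'. *)
Lemma injective_copresentation_step (X X' : C) (x : hom X X') :
  enough_injectives S -> adm_mono S x ->
  forall t : injective_copresentation X,
  exists (t' : injective_copresentation X') (m : hom (ic_obj t) (ic_obj t'))
      (w : hom (ic_coker t) (ic_coker t')),
    [/\ adm_mono S m, adm_mono S w, m \oc ic_incl t = ic_incl t' \oc x
      & w \oc ic_proj t = ic_proj t' \oc m].
Proof.
move=> enough ax [I W i p /= injI Sip].
have [J [iJ [m0 [pJ [po pm SJ]]]]] := exact_pushout_seq ex x Sip.
have am0 : adm_mono S m0 by apply: (adm_mono_pushout ex (is_pushout_sym po)).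
have [I' [m1 [injI' am1]]] := enough J.
have [W' [p' Sp']] : adm_mono S (m1 \oc iJ).
  by apply: (exact_mono_comp ex _ am1); exists W, pJ.
have [V [q Sq]] := am1.
have [w ew] : exists w, w \oc pJ = p' \oc m1.
  by apply: (exact_desc ex SJ); rewrite -compA (exact_comp0 ex Sp').
have [t et] : exists t, t \oc p' = q.
  by apply: (exact_desc ex Sp'); rewrite compA (exact_comp0 ex Sq) comp0m.
exists (InjectiveCopresentation injI' Sp'), (m1 \oc m0), w; split=> //=.
- exact: (exact_mono_comp ex am0 am1).
- by exists V, t; apply: (exact_noether ex SJ Sq Sp' ew et).
- by rewrite -!compA po.1.
- by rewrite -pm !compA ew.
Qed.

End ProjectivesInjectives.

(** * Diagrams and their components *)

(** Dependent choice along the indices 0, ..., k.  Each T i is required to be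
    inhabited so that a family defined only up to n is still a total one; it is
    then corrected at the index n.+1. *)
Lemma ord_dependent_choice k (T : 'I_k.+1 -> Type)
    (R : forall i : 'I_k, T (osrc i) -> T (otgt i) -> Prop) :
    (forall i, inhabited (T i)) ->
    (forall i (t : T (osrc i)), exists t' : T (otgt i), R i t t') ->
  exists f : forall i, T i, forall i, R i (f (osrc i)) (f (otgt i)).
Proof.
move=> inhT stepR.
suff /(_ k (leqnn k))[f fR] : forall n, (n <= k)%N ->
    exists f : forall i, T i,
      forall i : 'I_k, (i < n)%N -> R i (f (osrc i)) (f (otgt i)).
  by exists f => i; apply: fR.
elim=> [_|n IHn ltnk].
  have /fin_all_exists[f _] i : exists t : T i, True.
    by case: (inhT i) => t; exists t.
  by exists f.
have [f fR] := IHn (ltnW ltnk).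
pose j := Ordinal ltnk.
have [t' Rt'] := stepR j (f (osrc j)).
exists (dfwith f t') => i; rewrite ltnS leq_eqVlt => /orP[/eqP eij|ltin].
  have -> : i = j by apply: val_inj.
  rewrite dfwith_in dfwith_out //.
  by rewrite -val_eqE /= /bump /= add1n neq_ltn ltnSn orbT.
rewrite !dfwith_out; first exact: fR.
  by rewrite -val_eqE /= /bump /= !add1n eqSS neq_ltn ltin orbT.
by rewrite -val_eqE /= /bump /= add1n neq_ltn ltnS (ltnW ltin) orbT.
Qed.

Section Components.
Variables (C : preadditive) (S : seq_class C) (k : nat).
Local Notation M := (@MMor C k S).
Implicit Types X Y Z : M.

(** The object of index i of a diagram. *)
Definition ob X (i : 'I_k.+1) : C := dobj (sval X) i.

(** The structure map of a diagram from index i to index i.+1. *)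
Definition mp X (i : 'I_k) : hom (ob X (osrc i)) (ob X (otgt i)) :=
  dmap (sval X) i.

(** The component of index i of a morphism of diagrams. *)
Definition cpt X Y (f : hom X Y) (i : 'I_k.+1) : hom (ob X i) (ob Y i) :=
  mor_val f i.

(** The diagram with given objects and admissible monomorphisms. *)
Definition mkob (X : 'I_k.+1 -> C)
    (x : forall i, hom (X (osrc i)) (X (otgt i)))
    (ax : forall i, adm_mono S (x i)) : M :=
  exist (@all_adm_mono C k S) (Diagram x) ax.

Lemma mp_adm_mono X i : adm_mono S (mp X i).
Proof. exact: (svalP X). Qed.

Lemma cpt_nat X Y (f : hom X Y) i :
  cpt f (otgt i) \oc mp X i = mp Y i \oc cpt f (osrc i).
Proof. by move/forallP/(_ i)/eqP: (mor_natural f). Qed.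

Lemma cpt_comp X Y Z (g : hom Y Z) (f : hom X Y) i :
  cpt (g \oc f) i = cpt g i \oc cpt f i.
Proof. by rewrite /cpt ffunE. Qed.

Lemma cpt_id X i : cpt (idm X) i = idm (ob X i).
Proof. by rewrite /cpt ffunE. Qed.

Lemma cptD X Y (f g : hom X Y) i : cpt (f + g) i = cpt f i + cpt g i.
Proof. by rewrite /cpt ffunE. Qed.

Lemma cpt0 X Y i : cpt (0 : hom X Y) i = 0.
Proof. by rewrite /cpt ffunE. Qed.

Lemma cpt_ext X Y (f g : hom X Y) : (forall i, cpt f i = cpt g i) -> f = g.
Proof. by move=> e; apply/val_inj/ffunP. Qed.

Lemma hom_of_cpt X Y (f : forall i, hom (ob X i) (ob Y i)) :
  (forall i, f (otgt i) \oc mp X i = mp Y i \oc f (osrc i)) ->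
  exists F : hom X Y, forall i, cpt F i = f i.
Proof.
move=> nf; have nF : @natural C k (sval X) (sval Y) [ffun i => f i].
  by apply/forallP=> i; rewrite !ffunE; apply/eqP/nf.
by exists (MorHom nF) => i; rewrite /cpt ffunE.
Qed.

Lemma MMor_is_kernel X Y Z (f : hom X Y) (g : hom Y Z) :
  (forall i, is_kernel (cpt f i) (cpt g i)) -> is_kernel f g.
Proof.
move=> H; apply: is_kernel_intro => [|W h h0|W h h0].
- by apply: cpt_ext => i; rewrite cpt_comp cpt0; case: (H i).
- apply: cpt_ext => i; apply: (is_kernel_mono (H i)).
  by rewrite -cpt_comp h0 !cpt0 compm0.
have /fin_all_exists[u uP] i : exists u, cpt f i \oc u = cpt h i.
  by apply: is_kernel_lift (H i) _; rewrite -cpt_comp h0 cpt0.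
have [|F FP] := hom_of_cpt (f := u).
  move=> i; apply: (is_kernel_mono (H _)).
  by rewrite !compA uP cpt_nat cpt_nat -compA uP.
by exists F; apply: cpt_ext => i; rewrite cpt_comp FP.
Qed.

Lemma MMor_is_cokernel X Y Z (f : hom X Y) (g : hom Y Z) :
  (forall i, is_cokernel (cpt f i) (cpt g i)) -> is_cokernel f g.
Proof.
move=> H; apply: is_cokernel_intro => [|W h h0|W h h0].
- by apply: cpt_ext => i; rewrite cpt_comp cpt0; case: (H i).
- apply: cpt_ext => i; apply: (is_cokernel_epi (H i)).
  by rewrite -cpt_comp h0 !cpt0 comp0m.
have /fin_all_exists[u uP] i : exists u, u \oc cpt g i = cpt h i.
  by apply: is_cokernel_desc (H i) _; rewrite -cpt_comp h0 cpt0.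
have [|F FP] := hom_of_cpt (f := u).
  move=> i; apply: (is_cokernel_epi (H _)).
  by rewrite -!compA uP -cpt_nat -cpt_nat compA uP.
by exists F; apply: cpt_ext => i; rewrite cpt_comp FP.
Qed.

Lemma MMor_is_pushout (X Y X' Y' : M) (f : hom X Y) (g : hom X X')
    (f' : hom X' Y') (g' : hom Y Y') :
  (forall i, is_pushout (cpt f i) (cpt g i) (cpt f' i) (cpt g' i)) ->
  is_pushout f g f' g'.
Proof.
move=> H; split=> [|W a b eab].
  by apply: cpt_ext => i; rewrite !cpt_comp; case: (H i).
have /fin_all_exists[u uP] i :
    exists u, u \oc cpt f' i = cpt a i /\ u \oc cpt g' i = cpt b i.
  by apply: is_pushout_desc (H i) _; rewrite -!cpt_comp eab.
have uf i : u i \oc cpt f' i = cpt a i by case: (uP i).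
have ug i : u i \oc cpt g' i = cpt b i by case: (uP i).
have [|F FP] := hom_of_cpt (f := u).
  move=> i; apply: (is_pushout_ext (H _)).
    by rewrite -!compA -!cpt_nat compA !uf cpt_nat -uf compA.
  by rewrite -!compA -!cpt_nat compA !ug cpt_nat -ug compA.
exists F; split=> [|v [va vb]].
  by split; apply: cpt_ext => i; rewrite cpt_comp FP.
apply: cpt_ext => i; apply: (is_pushout_ext (H i)).
  by rewrite FP uf -va cpt_comp.
by rewrite FP ug -vb cpt_comp.
Qed.

Lemma MMor_is_pullback (Y Z Y' Z' : M) (f : hom Y Z) (g : hom Z' Z)
    (f' : hom Y' Z') (g' : hom Y' Y) :
  (forall i, is_pullback (cpt f i) (cpt g i) (cpt f' i) (cpt g' i)) ->
  is_pullback f g f' g'.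
Proof.
move=> H; split=> [|W a b eab].
  by apply: cpt_ext => i; rewrite !cpt_comp; case: (H i).
have /fin_all_exists[u uP] i :
    exists u, cpt f' i \oc u = cpt a i /\ cpt g' i \oc u = cpt b i.
  by apply: is_pullback_lift (H i) _; rewrite -!cpt_comp eab.
have uf i : cpt f' i \oc u i = cpt a i by case: (uP i).
have ug i : cpt g' i \oc u i = cpt b i by case: (uP i).
have [|F FP] := hom_of_cpt (f := u).
  move=> i; apply: (is_pullback_ext (H _)).
    by rewrite !compA cpt_nat -[RHS]compA !uf cpt_nat.
  by rewrite !compA cpt_nat -[RHS]compA !ug cpt_nat.
exists F; split=> [|v [va vb]].
  by split; apply: cpt_ext => i; rewrite cpt_comp FP.
apply: cpt_ext => i; apply: (is_pullback_ext (H i)).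
  by rewrite FP uf -va cpt_comp.
by rewrite FP ug -vb cpt_comp.
Qed.

Lemma MMor_is_iso X Y (f : hom X Y) i : is_iso f -> is_iso (cpt f i).
Proof.
move=> [g [e1 e2]]; exists (cpt g i).
by rewrite -!cpt_comp e1 e2 !cpt_id.
Qed.

Lemma MMor_classP X Y Z (f : hom X Y) (g : hom Y Z) :
  MMor_class f g <-> forall i, S (cpt f i) (cpt g i).
Proof. by []. Qed.

End Components.

(** * The exact structure on diagrams of admissible monomorphisms *)

Section MonomorphismCategory.
Variables (C : preadditive) (S : seq_class C) (k : nat).
Hypothesis ex : is_exact S.
Local Notation M := (@MMor C k S).
Local Notation MS := (@MMor_class C k S).
Implicit Types X Y Z : M.

Lemma MMor_adm_mono_cpt X Y (f : hom X Y) i :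
  adm_mono MS f -> adm_mono S (cpt f i).
Proof. by move=> [Z [g /MMor_classP/(_ i)Sfg]]; exists (ob Z i), (cpt g i). Qed.

Lemma MMor_adm_epi_cpt X Y (f : hom X Y) i :
  adm_epi MS f -> adm_epi S (cpt f i).
Proof. by move=> [Z [g /MMor_classP/(_ i)Sgf]]; exists (ob Z i), (cpt g i). Qed.

(** A morphism is an admissible monomorphism when its components are and the
    maps induced between their cokernels are, so that the cokernels form an
    object of MMor_k. *)
Lemma MMor_adm_mono X Y (f : hom X Y) :
    (forall i, adm_mono S (cpt f i)) ->
    (forall (i : 'I_k) (W W' : C) (p : hom (ob Y (osrc i)) W)
        (p' : hom (ob Y (otgt i)) W') (w : hom W W'),
      S (cpt f (osrc i)) p -> S (cpt f (otgt i)) p' ->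
      w \oc p = p' \oc mp Y i -> adm_mono S w) ->
  adm_mono MS f.
Proof.
move=> /fin_all_exists[W /fin_all_exists[p Sp]] H.
have /fin_all_exists[w wP] (i : 'I_k) :
    exists w : hom (W (osrc i)) (W (otgt i)),
      w \oc p (osrc i) = p (otgt i) \oc mp Y i.
  apply: (exact_desc ex (Sp _)).
  by rewrite -compA -cpt_nat compA (exact_comp0 ex (Sp _)) comp0m.
have aw i : adm_mono S (w i) by apply: (H _ _ _ _ _ _ (Sp _) (Sp _) (wP i)).
have [|P PE] := @hom_of_cpt _ _ _ Y (mkob aw) p; first by move=> i; rewrite -wP.
by exists (mkob aw), P => i; move: (PE i) (Sp i); rewrite /cpt => ->.
Qed.

(** The analogous criterion for epimorphisms, with the maps induced between the
    kernels; these must be admissible monomorphisms too, so that this is not the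
    dual of the previous criterion. *)
Lemma MMor_adm_epi X Y (f : hom X Y) :
    (forall i, adm_epi S (cpt f i)) ->
    (forall (i : 'I_k) (K K' : C) (j : hom K (ob X (osrc i)))
        (j' : hom K' (ob X (otgt i))) (l : hom K K'),
      S j (cpt f (osrc i)) -> S j' (cpt f (otgt i)) ->
      j' \oc l = mp X i \oc j -> adm_mono S l) ->
  adm_epi MS f.
Proof.
move=> /fin_all_exists[K /fin_all_exists[j Sj]] H.
have /fin_all_exists[l lP] (i : 'I_k) :
    exists l : hom (K (osrc i)) (K (otgt i)),
      j (otgt i) \oc l = mp X i \oc j (osrc i).
  apply: (exact_lift ex (Sj _)).
  by rewrite compA cpt_nat -compA (exact_comp0 ex (Sj _)) compm0.
have al i : adm_mono S (l i) by apply: (H _ _ _ _ _ _ (Sj _) (Sj _) (lP i)).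
have [|J JE] := @hom_of_cpt _ _ _ (mkob al) X j; first by move=> i; rewrite -lP.
by exists (mkob al), J => i; move: (JE i) (Sj i); rewrite /cpt => ->.
Qed.

Lemma MMor_additive : is_additive M.
Proof.
have [[Z Z0] bip] := exact_additive ex; split.
  have [Z00 aZ] : idm Z = 0 /\ adm_mono S (idm Z).
    by split; [apply/is_zero_object_idm0 | apply: exact_mono_id ex Z].
  exists (@mkob _ S k (fun=> Z) (fun=> idm Z) (fun=> aZ)).
  by apply/is_zero_object_idm0/cpt_ext => i; rewrite cpt_id cpt0.
move=> X Y.
have /fin_all_exists[B /fin_all_exists[i1 /fin_all_exists[i2
  /fin_all_exists[p1 /fin_all_exists[p2 bB]]]]] i := bip (ob X i) (ob Y i).
have e11 i : p1 i \oc i1 i = idm _ by case: (bB i).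
have e22 i : p2 i \oc i2 i = idm _ by case: (bB i).
have e12 i : p1 i \oc i2 i = 0 by case: (bB i).
have e21 i : p2 i \oc i1 i = 0 by case: (bB i).
have e1 i : i1 i \oc p1 i + i2 i \oc p2 i = idm _ by case: (bB i).
pose b (i : 'I_k) := i1 (otgt i) \oc mp X i \oc p1 (osrc i)
  + i2 (otgt i) \oc mp Y i \oc p2 (osrc i).
have bi1 i : b i \oc i1 (osrc i) = i1 (otgt i) \oc mp X i.
  by rewrite compDl -!compA e11 e21 !compm0 addr0 compm1.
have bi2 i : b i \oc i2 (osrc i) = i2 (otgt i) \oc mp Y i.
  by rewrite compDl -!compA e12 e22 !compm0 add0r compm1.
have pb1 i : mp X i \oc p1 (osrc i) = p1 (otgt i) \oc b i.
  by rewrite compDr !compA e11 e12 !comp0m addr0 comp1m.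
have pb2 i : mp Y i \oc p2 (osrc i) = p2 (otgt i) \oc b i.
  by rewrite compDr !compA e21 e22 !comp0m add0r comp1m.
have ab i : adm_mono S (b i).
  apply: (adm_mono_extension ex (exact_biproduct ex (bB _))
    (exact_biproduct ex (bB _)) (bi1 i) (pb2 i)); exact: mp_adm_mono.
have [|I1 I1E] := @hom_of_cpt _ _ _ X (mkob ab) i1.
  by move=> i; rewrite -bi1.
have [|I2 I2E] := @hom_of_cpt _ _ _ Y (mkob ab) i2.
  by move=> i; rewrite -bi2.
have [|P1 P1E] := @hom_of_cpt _ _ _ (mkob ab) X p1.
  by move=> i; rewrite pb1.
have [|P2 P2E] := @hom_of_cpt _ _ _ (mkob ab) Y p2.
  by move=> i; rewrite pb2.
exists (mkob ab), I1, I2, P1, P2.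
split; apply: cpt_ext => i;
  rewrite ?cptD !cpt_comp ?cpt_id ?cpt0 ?I1E ?I2E ?P1E ?P2E;
  by [exact: e11 | exact: e22 | exact: e12 | exact: e21 | exact: e1].
Qed.

Lemma MMor_mono_comp X Y Z (f : hom X Y) (g : hom Y Z) :
  adm_mono MS f -> adm_mono MS g -> adm_mono MS (g \oc f).
Proof.
move=> af ag; have [U [p /MMor_classP Sp]] := af.
have [V [q /MMor_classP Sq]] := ag.
apply: MMor_adm_mono => [i|i W W' r r' w].
  by rewrite cpt_comp; apply: (exact_mono_comp ex); exact: MMor_adm_mono_cpt.
rewrite !cpt_comp => Sr Sr' wr.
have st j (W0 : C) (r0 : hom (ob Z j) W0) : S (cpt g j \oc cpt f j) r0 ->
    exists (s : hom (ob U j) W0) (t : hom W0 (ob V j)),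
      [/\ s \oc cpt p j = r0 \oc cpt g j, t \oc r0 = cpt q j & S s t].
  move=> Sr0; have [s es] : exists s, s \oc cpt p j = r0 \oc cpt g j.
    by apply: (exact_desc ex (Sp j)); rewrite -compA (exact_comp0 ex Sr0).
  have [t et] : exists t, t \oc r0 = cpt q j.
    apply: (exact_desc ex Sr0).
    by rewrite compA (exact_comp0 ex (Sq j)) comp0m.
  by exists s, t; split=> //; apply: (exact_noether ex (Sp j) (Sq j) Sr0).
have [s [t [es et Sst]]] := st _ _ _ Sr.
have [s' [t' [es' et' Sst']]] := st _ _ _ Sr'.
apply: (adm_mono_extension ex Sst Sst' (a := mp U i) (c := mp V i));
  try exact: mp_adm_mono.
- apply: (exact_epic ex (Sp _)).
  by rewrite -!compA es -cpt_nat compA wr [RHS]compA es' -!compA cpt_nat.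
- apply: (exact_epic ex Sr).
  by rewrite -!compA et wr [RHS]compA et' cpt_nat.
Qed.

Lemma MMor_epi_comp X Y Z (f : hom X Y) (g : hom Y Z) :
  adm_epi MS f -> adm_epi MS g -> adm_epi MS (g \oc f).
Proof.
move=> af ag; have [K [i /MMor_classP Si]] := af.
have [L [j /MMor_classP Sj]] := ag.
apply: MMor_adm_epi => [h|h N N' n n' l].
  by rewrite cpt_comp; apply: (exact_epi_comp ex); exact: MMor_adm_epi_cpt.
rewrite !cpt_comp => Sn Sn' ln.
have ts h0 (N0 : C) (n0 : hom N0 (ob X h0)) : S n0 (cpt g h0 \oc cpt f h0) ->
    exists (t : hom (ob K h0) N0) (s : hom N0 (ob L h0)),
      [/\ n0 \oc t = cpt i h0, cpt j h0 \oc s = cpt f h0 \oc n0 & S t s].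
  move=> Sn0; have [s es] : exists s, cpt j h0 \oc s = cpt f h0 \oc n0.
    by apply: (exact_lift ex (Sj h0)); rewrite compA (exact_comp0 ex Sn0).
  have [t et] : exists t, n0 \oc t = cpt i h0.
    apply: (exact_lift ex Sn0).
    by rewrite -compA (exact_comp0 ex (Si h0)) compm0.
  exists t, s; split=> //.
  exact: (exact_noether_kernels ex (Si h0) (Sj h0) Sn0).
have [t [s [et es Sts]]] := ts _ _ _ Sn.
have [t' [s' [et' es' Sts']]] := ts _ _ _ Sn'.
apply: (adm_mono_extension ex Sts Sts' (a := mp K h) (c := mp L h));
  try exact: mp_adm_mono.
- apply: (exact_monic ex Sn').
  by rewrite !compA ln et' -compA et cpt_nat.
- apply: (exact_monic ex (Sj _)).
  by rewrite !compA es' cpt_nat -compA es -[RHS]compA ln !compA cpt_nat.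
Qed.

Lemma MMor_pushout X Y (X' : M) (f : hom X Y) (g : hom X X') :
  adm_mono MS f ->
  exists (Y' : M) (f' : hom X' Y') (g' : hom Y Y'),
    is_pushout f g f' g' /\ adm_mono MS f'.
Proof.
move=> [W [p /MMor_classP Sp]].
have /fin_all_exists[Y' /fin_all_exists[f' /fin_all_exists[g'
  /fin_all_exists[p' H]]]] i := exact_pushout_seq ex (cpt g i) (Sp i).
have po i : is_pushout (cpt f i) (cpt g i) (f' i) (g' i) by case: (H i).
have pg i : p' i \oc g' i = cpt p i by case: (H i).
have Sf' i : S (f' i) (p' i) by case: (H i).
have /fin_all_exists[y yP] (i : 'I_k) :
    exists y : hom (Y' (osrc i)) (Y' (otgt i)),
    y \oc f' (osrc i) = f' (otgt i) \oc mp X' i /\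
    y \oc g' (osrc i) = g' (otgt i) \oc mp Y i.
  apply: (is_pushout_desc (po _)).
  by rewrite -!compA -!cpt_nat !compA (po _).1.
have yf i : y i \oc f' (osrc i) = f' (otgt i) \oc mp X' i by case: (yP i).
have yg i : y i \oc g' (osrc i) = g' (otgt i) \oc mp Y i by case: (yP i).
have py i : mp W i \oc p' (osrc i) = p' (otgt i) \oc y i.
  apply: (is_pushout_ext (po _)); rewrite -!compA.
    by rewrite yf [RHS]compA !(exact_comp0 ex (Sf' _)) comp0m compm0.
  by rewrite yg [RHS]compA !pg cpt_nat.
have ay i : adm_mono S (y i).
  apply: (adm_mono_extension ex (Sf' _) (Sf' _) (yf i) (py i));
    exact: mp_adm_mono.
have [|F FE] := @hom_of_cpt _ _ _ X' (mkob ay) f'.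
  by move=> i; rewrite -yf.
have [|G GE] := @hom_of_cpt _ _ _ Y (mkob ay) g'.
  by move=> i; rewrite -yg.
have [|P PE] := @hom_of_cpt _ _ _ (mkob ay) W p'; first by move=> i; rewrite py.
exists (mkob ay), F, G; split.
  by apply: MMor_is_pushout => i; rewrite FE GE.
by exists W, P; apply/MMor_classP => i; rewrite FE PE.
Qed.

Lemma MMor_pullback Y Z (Z' : M) (f : hom Y Z) (g : hom Z' Z) :
  adm_epi MS f ->
  exists (Y' : M) (f' : hom Y' Z') (g' : hom Y' Y),
    is_pullback f g f' g' /\ adm_epi MS f'.
Proof.
move=> [K [j /MMor_classP Sj]].
have /fin_all_exists[Y' /fin_all_exists[f' /fin_all_exists[g'
  /fin_all_exists[j' H]]]] i := exact_pullback_seq ex (cpt g i) (Sj i).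
have pb i : is_pullback (cpt f i) (cpt g i) (f' i) (g' i) by case: (H i).
have gj i : g' i \oc j' i = cpt j i by case: (H i).
have Sf' i : S (j' i) (f' i) by case: (H i).
have /fin_all_exists[y yP] (i : 'I_k) :
    exists y : hom (Y' (osrc i)) (Y' (otgt i)),
    f' (otgt i) \oc y = mp Z' i \oc f' (osrc i) /\
    g' (otgt i) \oc y = mp Y i \oc g' (osrc i).
  apply: (is_pullback_lift (pb _)).
  by rewrite !compA !cpt_nat -!compA (pb _).1.
have fy i : f' (otgt i) \oc y i = mp Z' i \oc f' (osrc i) by case: (yP i).
have gy i : g' (otgt i) \oc y i = mp Y i \oc g' (osrc i) by case: (yP i).
have yj i : y i \oc j' (osrc i) = j' (otgt i) \oc mp K i.
  apply: (is_pullback_ext (pb _)); rewrite !compA.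
    by rewrite fy -compA !(exact_comp0 ex (Sf' _)) comp0m compm0.
  by rewrite gy -compA !gj cpt_nat.
have ay i : adm_mono S (y i).
  apply: (adm_mono_extension ex (Sf' _) (Sf' _) (yj i) (esym (fy i)));
    exact: mp_adm_mono.
have [|F FE] := @hom_of_cpt _ _ _ (mkob ay) Z' f'.
  by move=> i; rewrite fy.
have [|G GE] := @hom_of_cpt _ _ _ (mkob ay) Y g'; first by move=> i; rewrite gy.
have [|J JE] := @hom_of_cpt _ _ _ K (mkob ay) j'.
  by move=> i; rewrite -yj.
exists (mkob ay), F, G; split.
  by apply: MMor_is_pullback => i; rewrite FE GE.
by exists K, J; apply/MMor_classP => i; rewrite FE JE.
Qed.

Lemma MMor_exact : is_exact MS.
Proof.
have [Z Z0] := MMor_additive.1.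
have cpt0id i : is_zero_object (ob Z i).
  by apply/is_zero_object_idm0; rewrite -cpt_id (Z0.1 _ (idm Z) 0) cpt0.
split.
- exact: MMor_additive.
- move=> X Y W i p /MMor_classP Sip; split.
    by apply: MMor_is_kernel => h; apply: (exact_kernel ex).
  by apply: MMor_is_cokernel => h; apply: (exact_cokernel ex).
- move=> X Y W X' Y' W' i p i' p' a b c ia ib ic ei ep /MMor_classP Sip.
  apply/MMor_classP => h.
  apply: (exact_iso_closed ex (MMor_is_iso h ia) (MMor_is_iso h ib)
    (MMor_is_iso h ic) _ _ (Sip h)); by rewrite -!cpt_comp ?ei ?ep.
- move=> X; exists Z, 0; apply/MMor_classP => i.
  by rewrite cpt_id; apply: exact_id_zero.
- move=> X; exists Z, 0; apply/MMor_classP => i.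
  by rewrite cpt_id; apply: exact_zero_id.
- exact: MMor_mono_comp.
- exact: MMor_epi_comp.
- exact: MMor_pushout.
- exact: MMor_pullback.
Qed.

End MonomorphismCategory.

(** * Projective and injective diagrams *)

Section Frobenius.
Variables (C : preadditive) (S : seq_class C) (k : nat).
Hypothesis frob : is_frobenius_exact S.
Local Notation M := (@MMor C k S).
Local Notation MS := (@MMor_class C k S).
Implicit Types X Y Z : M.
Let ex := frobenius_exact frob.

Lemma MMor_projective X :
  (forall i, is_projective S (ob X i)) -> is_projective MS X.
Proof.
move=> projX Y Z p f ap.
pose T i := {g : hom (ob X i) (ob Y i) | cpt p i \oc g = cpt f i}.
pose R i (g : T (osrc i)) (g' : T (otgt i)) :=
  sval g' \oc mp X i = mp Y i \oc sval g.
have lift i : exists g, cpt p i \oc g = cpt f i.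
  by apply: (projX i); apply: MMor_adm_epi_cpt.
have [i||g gR] := @ord_dependent_choice k T R.
- by have [g eg] := lift i; split; exists g.
- move=> i [g eg]; have [g' eg'] := lift (otgt i).
  (* ob X (osrc i) is injective, so that mp X i has a retraction r, with which
     the lift g' is made natural *)
  have [r er] : exists r, r \oc mp X i = idm _.
    have injX : is_injective S (ob X (osrc i)).
      by apply/(frobenius_proj_inj frob).
    exact: injX (mp_adm_mono X i).
  pose h := g' + (mp Y i \oc g - g' \oc mp X i) \oc r.
  have eh : cpt p (otgt i) \oc h = cpt f (otgt i).
    rewrite compDr compA compBr !compA eg' cpt_nat -compA eg cpt_nat subrr.
    by rewrite comp0m addr0.
  exists (exist _ h eh); rewrite /R /= compDl -compA er compm1.
  by rewrite addrC subrK.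
have [F FE] := hom_of_cpt (f := fun i => sval (g i)) gR.
by exists F; apply: cpt_ext => i; rewrite cpt_comp FE (svalP (g i)).
Qed.

Lemma MMor_injective X :
  (forall i, is_injective S (ob X i)) -> is_injective MS X.
Proof.
move=> injX Y Z j f aj; have [W [q /MMor_classP Sq]] := aj.
pose T i := {h : hom (ob Z i) (ob X i) | h \oc cpt j i = cpt f i}.
pose R i (h : T (osrc i)) (h' : T (otgt i)) :=
  sval h' \oc mp Z i = mp X i \oc sval h.
have ext i : exists h, h \oc cpt j i = cpt f i.
  by apply: (injX i); apply: MMor_adm_mono_cpt.
have [i||h hR] := @ord_dependent_choice k T R.
- by have [h eh] := ext i; split; exists h.
- move=> i [h eh]; have [h' eh'] := ext (otgt i).
  (* the defect of naturality of h and h' factors through the cokernel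
     ob W (osrc i) of the component of j, and extends to ob W (otgt i) *)
  have [|d ed] := exact_desc ex (Sq (osrc i))
    (f := mp X i \oc h - h' \oc mp Z i).
    by rewrite compBl -!compA eh -!cpt_nat compA eh' subrr.
  have [e ee] := injX _ _ _ _ d (mp_adm_mono W i).
  pose h2 := h' + e \oc cpt q (otgt i).
  have eh2 : h2 \oc cpt j (otgt i) = cpt f (otgt i).
    by rewrite compDl -compA (exact_comp0 ex (Sq _)) compm0 addr0.
  exists (exist _ h2 eh2); rewrite /R /= compDl -compA cpt_nat compA ee ed.
  by rewrite addrC subrK.
have [F FE] := hom_of_cpt (f := fun i => sval (h i)) hR.
by exists F; apply: cpt_ext => i; rewrite cpt_comp FE (svalP (h i)).
Qed.

Lemma MMor_projective_quotient X : exists (P : M) (p : hom P X),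
  (forall i, is_projective S (ob P i)) /\ adm_epi MS p.
Proof.
pose T i := projective_presentation S (ob X i).
pose R i (t : T (osrc i)) (t' : T (otgt i)) :=
  exists (l : hom (pp_ker t) (pp_ker t')) (m : hom (pp_obj t) (pp_obj t')),
    [/\ adm_mono S l, adm_mono S m, m \oc pp_incl t = pp_incl t' \oc l
      & pp_proj t' \oc m = mp X i \oc pp_proj t].
have [i||t tR] := @ord_dependent_choice k T R.
- have [P [p [projP [K [j Sj]]]]] := frobenius_enough_proj frob (ob X i).
  by split; exists K P j p.
- move=> i t.
  exact: (projective_presentation_step ex (mp X i)
    (frobenius_enough_proj frob) t).
have /fin_all_exists[l /fin_all_exists[m H]] := tR.
have al i : adm_mono S (l i) by case: (H i).
have am i : adm_mono S (m i) by case: (H i).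
pose KM : M := @mkob _ S k (fun i => pp_ker (t i)) l al.
pose PM : M := @mkob _ S k (fun i => pp_obj (t i)) m am.
have [|J JE] := @hom_of_cpt _ _ _ KM PM (fun i => pp_incl (t i)).
  by move=> i; case: (H i).
have [|Q QE] := @hom_of_cpt _ _ _ PM X (fun i => pp_proj (t i)).
  by move=> i; case: (H i).
exists PM, Q; split=> [i|]; first exact: pp_projective (t i).
exists KM, J; apply/MMor_classP => i; rewrite JE QE.
exact: pp_exact (t i).
Qed.

Lemma MMor_injective_sub X : exists (I : M) (i : hom X I),
  (forall h, is_injective S (ob I h)) /\ adm_mono MS i.
Proof.
pose T h := injective_copresentation S (ob X h).
pose R h (t : T (osrc h)) (t' : T (otgt h)) :=
  exists (m : hom (ic_obj t) (ic_obj t')) (w : hom (ic_coker t) (ic_coker t')),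
    [/\ adm_mono S m, adm_mono S w, m \oc ic_incl t = ic_incl t' \oc mp X h
      & w \oc ic_proj t = ic_proj t' \oc m].
have [h||t tR] := @ord_dependent_choice k T R.
- have [I [i [injI [W [p Si]]]]] := frobenius_enough_inj frob (ob X h).
  by split; exists I W i p.
- move=> h t; exact: (injective_copresentation_step ex
    (frobenius_enough_inj frob) (mp_adm_mono X h) t).
have /fin_all_exists[m /fin_all_exists[w H]] := tR.
have am h : adm_mono S (m h) by case: (H h).
have aw h : adm_mono S (w h) by case: (H h).
pose IM : M := @mkob _ S k (fun h => ic_obj (t h)) m am.
pose WM : M := @mkob _ S k (fun h => ic_coker (t h)) w aw.
have [|J JE] := @hom_of_cpt _ _ _ X IM (fun h => ic_incl (t h)).
  by move=> h; case: (H h).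
have [|Q QE] := @hom_of_cpt _ _ _ IM WM (fun h => ic_proj (t h)).
  by move=> h; case: (H h).
exists IM, J; split=> [h|]; first exact: ic_injective (t h).
exists WM, Q; apply/MMor_classP => h; rewrite JE QE.
exact: ic_exact (t h).
Qed.

Lemma MMor_projectiveP X :
  is_projective MS X <-> forall i, is_projective S (ob X i).
Proof.
split=> [projX i|]; last exact: MMor_projective.
have [P [p [projP ap]]] := MMor_projective_quotient X.
have [s ps] := projX _ _ p (idm X) ap.
by apply: (is_projective_retract (s := cpt s i) (r := cpt p i) _ (projP i));
  rewrite -cpt_comp ps cpt_id.
Qed.

Lemma MMor_injectiveP X :
  is_injective MS X <-> forall i, is_injective S (ob X i).
Proof.
split=> [injX h|]; last exact: MMor_injective.
have [I [i [injI ai]]] := MMor_injective_sub X.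
have [r ri] := injX _ _ i (idm X) ai.
by apply: (is_injective_retract (s := cpt i h) (r := cpt r h) _ (injI h));
  rewrite -cpt_comp ri cpt_id.
Qed.

End Frobenius.

Theorem theorem3p12 (C : preadditive) (S : seq_class C) (k : nat) :
  is_frobenius_exact S -> is_frobenius_exact (@MMor_class C k S).
Proof.
move=> frob; split.
- exact: MMor_exact (frobenius_exact frob).
- move=> X; split=> [/(MMor_projectiveP frob) H | /(MMor_injectiveP frob) H].
    by apply/(MMor_injectiveP frob) => i; apply/(frobenius_proj_inj frob).
  by apply/(MMor_projectiveP frob) => i; apply/(frobenius_proj_inj frob).
- move=> X; have [P [p [projP ap]]] := MMor_projective_quotient frob X.
  by exists P, p; split=> //; apply: MMor_projective.
- move=> X; have [I [i [injI ai]]] := MMor_injective_sub frob X.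
  by exists I, i; split=> //; apply: MMor_injective.
Qed.
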